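(* Consider the control system $\dot x(t)=f(x(t))+g(x(t))u(t)$ with $x\in\mathbb{R}^n$, $u\in U$, where $U\subseteq\mathbb{R}^m$ is compact and $f:\mathbb{R}^n\to\mathbb{R}^n$, $g:\mathbb{R}^n\to\mathbb{R}^{n\times m}$ are $r$-times continuously differentiable, $r\ge 1$. Let $h:\mathbb{R}^n\to\mathbb{R}$ be of relative-degree $r$ with respect to this system and let $S=\{x\in\mathbb{R}^n : h(x)\le 0\}$. Let $u^*:\mathbb{R}^n\to U$ be a control law such that: (A1) for every $x(0)\in S$, the closed-loop system $\dot x=f(x)+g(x)u^*(x)$ admits a unique solution $x(t)$, $t\ge 0$; (A2) for every $x\in S$, the quantity $$H(x)=\sup_{t\ge 0}\psi_h(t;x,u^* )$$ exists and is finite, and $H$ is differentiable at $x$. Let $S_H=\{x\in\mathbb{R}^n : H(x)\le 0\}$ and assume $S_H\neq\emptyset$. Then $H$ is a zeroing control barrier function on $S_H$ for the control set $U$; that is, there exists an extended class-$\mathcal{K}$ function $\alpha$ such that $$\inf_{u\in U}\left[L_fH(x)+L_gH(x)\,u-\alpha(-H(x))\right]\le 0\qquad\text{for all }x\in S_H .$$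
   Context: Lie derivatives: for a real-valued function $\phi$ on $\mathbb{R}^n$ differentiable at $x$, $L_f\phi(x)=\frac{\partial \phi}{\partial x}(x)f(x)\in\mathbb{R}$ and $L_g\phi(x)=\frac{\partial\phi}{\partial x}(x)g(x)\in\mathbb{R}^{1\times m}$; $L_f^0\phi=\phi$, $L_f^{k}\phi=L_f(L_f^{k-1}\phi)$. Relative degree: $h:\mathbb{R}^n\to\mathbb{R}$ is of relative-degree $r$ with respect to the system if (1) $h$ is $r$-times continuously differentiable; (2) $L_gL_f^kh(x)=0$ for all $x\in\mathbb{R}^n$ and all $k=0,1,\dots,r-2$ (vacuous if $r=1$); (3) there is a nonempty set $C\subseteq\mathbb{R}^n$ such that $L_gL_f^{r-1}h(x)\ne 0$ for all $x\in C$. Extended class-$\mathcal{K}$: $\alpha:\mathbb{R}\to\mathbb{R}$ that is strictly increasing with $\alpha(0)=0$. Flow: for a control law $u^*$, let $y(t)$, $t\ge0$, be the solution of $\dot y=f(y)+g(y)u^*(y)$, $y(0)=x$; then $\psi_h(t;x,u^* )=h(y(t))$. ''Solution'' means a locally absolutely continuous function satisfying the ODE for almost every $t\ge 0$. $H(x)$ is defined at those $x$ for which this solution exists uniquely for all $t\ge 0$ and the supremum is finite; differentiability of $H$ at $x\in S$ includes the requirement that $H$ is defined in a neighbourhood of $x$. Taking $t=0$ in the supremum gives $H\ge h$, so $S_H\subseteq S$. *)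

(* Defs.v *)
From HB Require Import structures.
From mathcomp Require Import all_boot all_order all_algebra.
From mathcomp Require Import all_classical all_reals all_analysis.
Set Implicit Arguments.
Unset Strict Implicit.
Unset Printing Implicit Defensive.
Import Order.TTheory GRing.Theory Num.Theory.
Import numFieldNormedType.Exports.
Local Open Scope classical_set_scope.
Local Open Scope ring_scope.

(* C^k through iterated directional derivatives: in finite dimension this is
   the usual class of k-times continuously differentiable maps. *)
Fixpoint Ck (R : realType) (V W : normedModType R) (k : nat) (F : V -> W) :
    Prop :=
  if k is k'.+1 then
    (forall x, differentiable F x) /\ (forall v, Ck k' (fun x => 'D_v F x))
  else continuous F.

Section Lie.
Context {R : realType} {n m : nat}.
Implicit Types (f : 'cV[R]_n -> 'cV[R]_n) (g : 'cV[R]_n -> 'M[R]_(n, m))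
  (phi : 'cV[R]_n -> R).

Definition gradient phi (x : 'cV[R]_n) : 'rV[R]_n :=
  \row_i 'd phi x (delta_mx i 0).

Definition Lf f phi (x : 'cV[R]_n) : R := (gradient phi x *m f x) 0 0.

Definition Lg g phi (x : 'cV[R]_n) : 'rV[R]_m := gradient phi x *m g x.

Definition Lfk f (k : nat) phi : 'cV[R]_n -> R := iter k (Lf f) phi.

Definition relative_degree f g (r : nat) (h : 'cV[R]_n -> R) : Prop :=
  [/\ Ck r h,
      forall (x : 'cV[R]_n) (k : nat), (k.+2 <= r)%N -> Lg g (Lfk f k h) x = 0
    & exists2 C : set 'cV[R]_n, C !=set0 &
        forall x, C x -> Lg g (Lfk f r.-1 h) x != 0].

End Lie.

Definition extended_classK (R : realType) (alpha : R -> R) : Prop :=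
  {homo alpha : s t / s < t} /\ alpha 0 = 0.

Definition abs_continuous (R : realType) (V : normedModType R) (a b : R)
    (y : R -> V) : Prop :=
  forall eps : R, 0 < eps -> exists2 delta : R, 0 < delta &
    forall (N : nat) (s t : 'I_N -> R),
      (forall i, a <= s i /\ s i <= t i /\ t i <= b) ->
      trivIset setT (fun i => [set` `]s i, t i[%R]) ->
      \sum_(i < N) (t i - s i) < delta ->
      \sum_(i < N) `|y (t i) - y (s i)| < eps.

Section Flow.
Context {R : realType} {n : nat}.
Implicit Types (F : 'cV[R]_n -> 'cV[R]_n) (x : 'cV[R]_n) (y z : R -> 'cV[R]_n).

(* Only the restriction of y to [0, +oo[ matters: the two-sided derivative
   at t = 0 is irrelevant because {0} is negligible. *)
Definition is_solution F x y : Prop :=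
  [/\ y 0 = x,
      forall T : R, 0 < T -> abs_continuous 0 T y
    & {ae (@lebesgue_measure R), forall t : R,
         0 <= t -> is_derive t (1 : R) y (F (y t))}].

Definition has_unique_solution F x : Prop :=
  exists2 y, is_solution F x y &
    forall z, is_solution F x z -> forall t, 0 <= t -> z t = y t.

(* The solution from x, with the constant x as default value when there is
   none. *)
Definition flow F x : R -> 'cV[R]_n :=
  xget (fun=> x) [set y | is_solution F x y].

Definition psi (h : 'cV[R]_n -> R) F (t : R) x : R := h (flow F x t).

Definition psi_values (h : 'cV[R]_n -> R) F x : set R :=
  [set psi h F t x | t in [set t | 0 <= t]].

(* H is a partial function: it is encoded by the total function Hfun together
   with its domain Hdom, outside of which the value of Hfun is meaningless. *)
Definition Hfun (h : 'cV[R]_n -> R) F x : R := sup (psi_values h F x).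

Definition Hdom (h : 'cV[R]_n -> R) F : set 'cV[R]_n :=
  [set x | has_unique_solution F x /\ has_sup (psi_values h F x)].

Definition H_differentiable (h : 'cV[R]_n -> R) F x : Prop :=
  (\forall x' \near x, Hdom h F x') /\ differentiable (Hfun h F) x.

Definition SH (h : 'cV[R]_n -> R) F : set 'cV[R]_n :=
  [set x | Hdom h F x /\ Hfun h F x <= 0].

End Flow.

Definition closed_loop (R : realType) (n m : nat) (f : 'cV[R]_n -> 'cV[R]_n)
    (g : 'cV[R]_n -> 'M[R]_(n, m)) (u : 'cV[R]_n -> 'cV[R]_m) :
    'cV[R]_n -> 'cV[R]_n :=
  fun x => f x + g x *m u x.

(* The infimum is taken in the extended reals, where it always exists. *)
Definition zeroing_CBF (R : realType) (n m : nat) (f : 'cV[R]_n -> 'cV[R]_n)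
    (g : 'cV[R]_n -> 'M[R]_(n, m)) (U : set 'cV[R]_m) (C : set 'cV[R]_n)
    (H : 'cV[R]_n -> R) : Prop :=
  exists2 alpha : R -> R, extended_classK alpha &
    forall x, C x ->
      (ereal_inf [set (Lf f H x + (Lg g H x *m u) 0 0 - alpha (- H x))%:E
                 | u in U] <= 0)%E.

(* Main.v *)
(** The class-K function is the identity, so it suffices to find, at each x with
    H x <= 0, controls in U along which dH(x) is at most an arbitrarily small
    positive number. By uniqueness of solutions H is nonincreasing along the
    closed-loop trajectory y from x. Since u* need not be continuous, y may fail
    to be differentiable at 0, and f(x) + g(x) u*(x) need not be its velocity
    there; instead, if dH(x) (f(x) + g(x) u) >= c > 0 for all u in U, continuity
    of f, g and boundedness of U force H to increase along y, a contradiction. *)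

Require Import Defs.
From HB Require Import structures.
From mathcomp Require Import all_boot all_order all_algebra.
From mathcomp Require Import all_classical all_reals all_analysis.
From mathcomp Require Import measurable_realfun lra.
Set Implicit Arguments.
Unset Strict Implicit.
Unset Printing Implicit Defensive.
Import Order.TTheory GRing.Theory Num.Theory.
Import numFieldNormedType.Exports.
Local Open Scope classical_set_scope.
Local Open Scope ring_scope.

(** * Translates of null sets and Cousin's lemma *)

Lemma negligible_translation (R : realType) (a : R) (N : set R) :
  (@lebesgue_measure R).-negligible N ->
  (@lebesgue_measure R).-negligible [set t | N (t + a)].
Proof.
move=> [A [mA A0 NA]].
pose tr : measurableTypeR R -> measurableTypeR R := fun t => t + a.
have mtr : measurable_fun setT tr.
  apply: continuous_measurable_fun => t.
  by apply: cvgD; [exact: cvg_id|exact: cvg_cst].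
exists (tr @^-1` A); split.
- by rewrite -[_ @^-1` _]setTI; exact: mtr.
(* The pushforward of Lebesgue measure under the translation gives half-open intervals their length,
   so by uniqueness it is Lebesgue measure. *)
- rewrite -[LHS]/(pushforward (@lebesgue_measure R) tr A) -A0.
  apply/esym/lebesgue_measure_unique; [move=> /= _ [[u v]] _ <-|exact: mA].
  rewrite /pushforward.
  have -> : tr @^-1` `]u, v]%classic = `]u - a, v - a]%classic.
    by apply/seteqP; split => t /=; rewrite !in_itv /= /tr ltrBlDr lerBrDr.
  rewrite !lebesgue_measure_itv /= !lte_fin ltrD2r.
  by case: ifP => // _; rewrite -!EFinB; congr EFin; lra.
- by move=> t /= /NA.
Qed.

(** The supremum [s] of the points that [P] reaches from [a] must be [b]: the gauge at [s] joins a
    reachable point just below [s] to points past [s]. *)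
Lemma cousin_induction (R : realType) (a b : R) (P : R -> R -> Prop) :
  a <= b ->
  (forall u v w, a <= u -> u <= v -> v <= w -> w <= b ->
    P u v -> P v w -> P u w) ->
  (forall t, a <= t -> t <= b -> exists2 d : R, 0 < d &
    forall u v, a <= u -> v <= b -> t - d < u -> u <= t -> t <= v ->
      v < t + d -> P u v) ->
  P a b.
Proof.
move=> ab Padd Ploc.
pose A := [set t | [/\ a <= t, t <= b & P a t]].
have Aa : A a.
  have [d d0 Pd] := Ploc a (lexx _) ab.
  by split => //; apply: Pd => //; lra.
have Aub : ubound A b by move=> t [].
have supA : has_sup A by split; [exists a | exists b].
pose s := sup A.
have as_ : a <= s by apply: ub_le_sup => //; exists b.
have sb : s <= b by apply: ge_sup => //; exists a.
have [d d0 Pd] := Ploc s as_ sb.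
have [t [at_ tb Pat] std] := sup_adherent d0 supA.
have ts : t <= s by apply: ub_le_sup; [exists b|split].
have Pext v : s <= v -> v <= b -> v < s + d -> P a v.
  move=> sv vb vd; apply: (Padd a t v) => //; first lra.
  by apply: Pd => //.
have [sb'|bs] := ltP s b; last by apply: Pext => //; lra.
pose v := Num.min b (s + d / 2).
have vb : v <= b by rewrite /v ge_min lexx.
have vd : v <= s + d / 2 by rewrite /v ge_min lexx orbT.
have sv : s < v by rewrite /v lt_min sb' /=; lra.
have : v <= s.
  apply: ub_le_sup; first by exists b.
  by split => //; [lra | apply: Pext => //; lra].
lra.
Qed.

(** * Chains of non-overlapping intervals *)

Section interval_chains.
Context {R : realType}.
Implicit Types (u v w : R) (s : seq (R * R)).

(** Left-to-right order stands for disjointness, and gaps are allowed. With lists, concatenation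
    provides the additivity that [cousin_induction] asks for. *)
Fixpoint itv_chain u v s : bool :=
  if s is i :: s' then [&& u <= i.1, i.1 <= i.2 & itv_chain i.2 v s']
  else u <= v.

Lemma itv_chain_le u v s : itv_chain u v s -> u <= v.
Proof.
elim: s u => [//|[p q] s IH] u /= /and3P[up pq /IH qv].
by rewrite (le_trans up) // (le_trans pq).
Qed.

Lemma itv_chain_widenl u w v s : u <= w -> itv_chain w v s -> itv_chain u v s.
Proof.
case: s => [|[p q] s] /= uw; first exact: le_trans.
by move=> /and3P[wp -> ->]; rewrite (le_trans uw).
Qed.

Lemma itv_chain_cat u v w s1 s2 :
  itv_chain u v s1 -> itv_chain v w s2 -> itv_chain u w (s1 ++ s2).
Proof.
elim: s1 u => [|[p q] s IH] u /=; first exact: itv_chain_widenl.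
by move=> /and3P[-> -> /IH H] /H.
Qed.

Lemma itv_chain_nth u v s k : itv_chain u v s -> (k < size s)%N ->
  let i := nth (0, 0) s k in [/\ u <= i.1, i.1 <= i.2 & i.2 <= v].
Proof.
elim: s u k => [//|[p q] s IH] u [|k] /= /and3P[up pq c].
  by move=> _; split => //; exact: itv_chain_le c.
move=> /(IH _ _ c) [qi -> ->]; split => //.
by rewrite (le_trans up) // (le_trans pq).
Qed.

Lemma itv_chain_nth_lt u v s j k : itv_chain u v s -> (j < k)%N ->
  (k < size s)%N -> (nth (0, 0) s j).2 <= (nth (0, 0) s k).1.
Proof.
elim: s u j k => [//|[p q] s IH] u [|j] [|k] //= /and3P[up pq c] jk ks.
  by have [] := itv_chain_nth c ks.
exact: (IH q j k).
Qed.

(** Chains inside an open set of small measure are therefore short. By induction: the first interval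
    is disjoint from the part of [G] to its right. *)
Lemma itv_chain_measure u v s (G : set R) : measurable G ->
  itv_chain u v s ->
  (forall i, i \in s -> `]i.1, i.2[%classic `<=` G) ->
  ((\sum_(i <- s) (i.2 - i.1))%:E <=
    @lebesgue_measure R (G `&` `]u, v[%classic))%E.
Proof.
move=> mG; elim: s u => [|[p q] s IH] u /=; first by rewrite big_nil.
move=> /and3P[up pq c] sG; rewrite big_cons EFinD.
have mI w : measurable (G `&` `]w, v[%classic : set (measurableTypeR R)).
  exact: measurableI.
have qv := itv_chain_le c.
apply: (@le_trans _ _ (@lebesgue_measure R `]p, q[%classic +
    @lebesgue_measure R (G `&` `]q, v[%classic))%E).
  apply: leeD; last by apply: IH => // i si; apply: sG; rewrite inE si orbT.
  rewrite lebesgue_measure_itv /= lte_fin; case: ltP => //= qp.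
  by rewrite lee_fin; lra.
have pq0 : `]p, q[%classic `&` (G `&` `]q, v[%classic) = set0.
  rewrite -subset0 => t [] /=; rewrite in_itv /= => /andP[_ tq] [_].
  by rewrite in_itv /= => /andP[qt _]; lra.
rewrite -(measureU (@lebesgue_measure R) (measurable_itv `]p, q[) (mI q) pq0).
apply: le_measure; rewrite ?inE; [|exact: mI|].
  by apply: measurableU; [exact: measurable_itv|exact: mI].
move=> t [tpq|[Gt tqv]].
  split; first by apply: (sG (p, q)); rewrite ?inE ?eqxx.
  by move: tpq => /=; rewrite !in_itv /= => /andP[? ?]; apply/andP; lra.
split => //; move: tqv => /=; rewrite !in_itv /= => /andP[? ?].
by apply/andP; lra.
Qed.

Lemma abs_continuous_itv_chain (V : normedModType R) (a b : R) (y : R -> V) :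
  abs_continuous a b y -> forall e : R, 0 < e -> exists2 d : R, 0 < d &
  forall s, itv_chain a b s -> \sum_(i <- s) (i.2 - i.1) < d ->
    \sum_(i <- s) `|y i.2 - y i.1| < e.
Proof.
move=> yac e e0; have [d d0 H] := yac e e0; exists d => // s c sd.
have := H (size s) (fun k => (nth (0, 0) s k).1) (fun k => (nth (0, 0) s k).2).
rewrite (big_nth (0, 0)) big_mkord; apply.
- by move=> k; have [] := itv_chain_nth c (ltn_ord k).
(* Intervals sharing a point have equal indices, since otherwise one ends before the other
   begins. *)
- move=> j k _ _ [t [/=]]; rewrite !in_itv /= => /andP[jt tj] /andP[kt tk].
  case: (ltngtP j k) => [jk|kj|]; last exact: val_inj.
    have jk' := itv_chain_nth_lt c jk (ltn_ord k).
    by have := le_lt_trans jk' (lt_trans kt tj); rewrite ltxx.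
  have kj' := itv_chain_nth_lt c kj (ltn_ord j).
  by have := le_lt_trans kj' (lt_trans jt tk); rewrite ltxx.
- by move: sd; rewrite (big_nth (0, 0)) big_mkord.
Qed.

End interval_chains.

(** * First-order expansions and growth of absolutely continuous curves *)

Lemma is_derive_first_order (R : realType) (V : normedModType R) (y : R -> V)
    (t : R) (d : V) : is_derive t (1 : R) y d -> forall e : R, 0 < e ->
  exists2 r : R, 0 < r &
    forall v, `|v - t| < r -> `|y v - y t - (v - t) *: d| <= e * `|v - t|.
Proof.
move=> [/derivable_nbhs + yd] e e0; rewrite yd => /eqaddoP /(_ e e0).
move=> /nbhs_norm0P [r /= r0 H]; exists r => // v vt.
have := H (v - t) vt.
rewrite -![(_ + _ : _ -> _) _]/(_ + _) -![(- _ : _ -> _) _]/(- _) /=.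
rewrite -![(_ + _ : _ -> _) _]/(_ + _) /= opprD addrA.
by rewrite [(v - t) *: (1 : R)]mulr1 subrK.
Qed.

Lemma differentiable_first_order (R : realType) (V W : normedModType R)
    (H : V -> W) (x : V) : differentiable H x -> forall e : R, 0 < e ->
  exists2 r : R, 0 < r &
    forall z, `|z - x| < r -> `|H z - H x - 'd H x (z - x)| <= e * `|z - x|.
Proof.
move=> /diff_locally /eqaddoP Hx e e0.
have /nbhs_norm0P [r /= r0 Hr] := Hx e e0; exists r => // z zx.
have := Hr (z - x) zx.
rewrite -![(_ + _ : _ -> _) _]/(_ + _) -![(- _ : _ -> _) _]/(- _) /=.
by rewrite -![(_ + _ : _ -> _) _]/(_ + _) /= opprD addrA subrK.
Qed.

(* A sublinear bound on the derivative integrates without any integral: Cousin's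
   lemma splits [a, b] into small intervals around points of differentiability
   and intervals inside an open set of small measure covering the exceptional
   null set; absolute continuity makes the contribution of the latter small. *)
Lemma abs_continuous_sublinear_growth (R : realType) (V : normedModType R)
    (p : V -> R) (K a b c : R) (y : R -> V) :
  (forall v w, p (v + w) <= p v + p w) ->
  (forall (k : R) v, 0 <= k -> p (k *: v) = k * p v) ->
  0 < K -> (forall v, p v <= K * `|v|) ->
  a <= b -> abs_continuous a b y ->
  {ae (@lebesgue_measure R), forall t, a <= t <= b ->
    exists2 d, is_derive t (1 : R) y d & p d <= c} ->
  p (y b - y a) <= c * (b - a).
Proof.
move=> pD pZ K0 pK ab yac yae.
(* The slack adds [e * (b - a)] from the points of differentiability, [e * K] from the variation of
   [y] over the chain, and [e] times the absolute value of [c] from the length of the chain. *)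
suff main (e : R) : 0 < e ->
    p (y b - y a) <= c * (b - a) + e * (b - a + K + `|c|).
  apply/ler_addgt0Pr => e e0.
  have M0 : 0 < b - a + K + `|c|.
    by rewrite ltr_wpDr // ltr_wpDl // subr_ge0.
  have := main (e / (b - a + K + `|c|)) (divr_gt0 e0 M0).
  by rewrite divfK // gt_eqF.
move=> e0; have [d1 d10 Hd1] := abs_continuous_itv_chain yac e0.
pose d := Num.min d1 e.
have d0 : 0 < d by rewrite /d lt_min d10 e0.
move: yae => /negligible_outer_measure yae.
have [G [oG NG muG]] := outer_measure_open_le (~` [set t | a <= t <= b ->
    exists2 d, is_derive t (1 : R) y d & p d <= c]) (divr_gt0 d0 (@ltr0Sn _ 1)).
rewrite yae add0e in muG.
have mG : measurable G by exact: open_measurable.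
(* The sum is the price of the intervals inside [G], where the derivative gives no control. *)
pose P u v := exists s, [/\ itv_chain u v s,
  forall i, i \in s -> `]i.1, i.2[%classic `<=` G &
  p (y v - y u) <= (c + e) * (v - u) +
    \sum_(i <- s) (K * `|y i.2 - y i.1| + `|c| * (i.2 - i.1))].
have [s [cs sG ps]] : P a b.
  apply: cousin_induction => //.
  - move=> u v w _ _ _ _ [s1 [c1 G1 p1]] [s2 [c2 G2 p2]].
    exists (s1 ++ s2); split; first exact: itv_chain_cat c2.
      by move=> i; rewrite mem_cat => /orP[]; [exact: G1|exact: G2].
    rewrite big_cat /= -(subrK (y v) (y w)) -addrA.
    apply: (le_trans (pD _ _)); lra.
  - move=> t at_ tb; have [Nt|] := pselect (a <= t <= b ->
      exists2 d, is_derive t (1 : R) y d & p d <= c).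
      have [|D yD pD'] := Nt; first by rewrite at_.
      have [r r0 Hr] := is_derive_first_order yD (divr_gt0 e0 K0).
      exists r => // u v au vb tru ut tv vtr; exists [::]; split => //=.
        exact: le_trans tv.
      rewrite big_nil addr0.
      have Hv := Hr v; rewrite ger0_norm ?subr_ge0 // in Hv.
      have {}Hv : `|y v - y t - (v - t) *: D| <= e / K * (v - t).
        by apply: Hv; lra.
      have Hu := Hr u; rewrite ler0_norm ?subr_le0 // opprB in Hu.
      have {}Hu : `|y u - y t - (u - t) *: D| <= e / K * (t - u).
        by apply: Hu; lra.
      (* Both endpoints are compared with the tag [t], which lies between them, so the two errors
         add up to a multiple of [v - u]. *)
      have -> : y v - y u = (v - u) *: D +
          ((y v - y t - (v - t) *: D) - (y u - y t - (u - t) *: D)).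
        rewrite opprD opprK addrACA opprB (addrA _ (y t)) subrK [RHS]addrCA.
        rewrite -scaleNr -!scalerDl [X in X *: D](_ : _ = 0) ?scale0r ?addr0 //.
        by lra.
      apply: (le_trans (pD _ _)); rewrite pZ ?subr_ge0 ?(le_trans ut) //.
      set rem := (_ - _ - _ - _).
      have Hrem : K * `|rem| <= e * (v - u).
        apply: (@le_trans _ _ (K * (e / K * (v - t) + e / K * (t - u)))).
          rewrite ler_pM2l //; apply: (le_trans (ler_normB _ _)).
          exact: lerD.
        rewrite -mulrDr mulrA mulrCA divff ?gt_eqF // mulr1.
        by rewrite ler_pM2l //; lra.
      have := pK rem.
      have : (v - u) * p D <= (v - u) * c by apply: ler_wpM2l => //; lra.
      lra.
    (* At an exceptional point the whole interval joins the chain; the length term in its price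
       compensates for a negative [c]. *)
    move=> Nt; have /nbhs_ballP [r /= r0 rG] : nbhs t G.
      by apply: open_nbhs_nbhs; split => //; exact: NG.
    exists r => // u v au vb tru ut tv vtr; exists [:: (u, v)]; split => /=.
    + by rewrite !lexx (le_trans ut).
    + move=> i; rewrite inE => /eqP -> z /=; rewrite in_itv /= => /andP[uz zv].
      by apply: rG; rewrite /ball /= ltr_norml; apply/andP; lra.
    + rewrite big_seq1 /=; have := pK (y v - y u).
      have : 0 <= (c + `|c|) * (v - u).
        by apply: mulr_ge0; [have := ler_norm (- c); rewrite normrN; lra|lra].
      have : 0 <= e * (v - u) by apply: mulr_ge0; lra.
      lra.
have sd : \sum_(i <- s) (i.2 - i.1) < d.
  have H := itv_chain_measure mG cs sG.
  have : ((\sum_(i <- s) (i.2 - i.1))%:E <= (d / 2)%:E)%E.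
    apply: (le_trans H); apply: le_trans muG.
    by apply: le_measure; rewrite ?inE //; exact: measurableI.
  by rewrite lee_fin; lra.
have sd1 : \sum_(i <- s) (i.2 - i.1) < d1 by rewrite (lt_le_trans sd) // ge_min lexx.
have sde : \sum_(i <- s) (i.2 - i.1) < e.
  by rewrite (lt_le_trans sd) // ge_min lexx orbT.
have := Hd1 s cs sd1.
move: ps; rewrite big_split /= -!mulr_sumr => ps ys.
have : K * \sum_(i <- s) `|y i.2 - y i.1| <= K * e by rewrite ler_pM2l // ltW.
have : `|c| * \sum_(i <- s) (i.2 - i.1) <= `|c| * e by rewrite ler_wpM2l // ltW.
lra.
Qed.

(** * Matrix norms and gradients *)

Lemma norm_mx_entry (R : realType) (n m : nat) (A : 'M[R]_(n, m)) i j :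
  `|A i j| <= `|A|.
Proof.
rewrite [leRHS]/Num.Def.normr /= mx_normrE.
by apply/bigmax_geP; right => /=; exists (i, j).
Qed.

Lemma norm_mulmx_col (R : realType) (n m : nat) (A : 'M[R]_(n, m))
    (u : 'cV[R]_m) : `|A *m u| <= m%:R * (`|A| * `|u|).
Proof.
rewrite [leLHS]/Num.Def.normr /= mx_normrE.
apply/bigmax_leP; split => [|[i j] _ /=].
  by rewrite !mulr_ge0.
rewrite mxE; apply: (le_trans (ler_norm_sum _ _ _)).
apply: (@le_trans _ _ (\sum_(k < m) `|A| * `|u|)).
  by apply: ler_sum => k _; rewrite normrM ler_pM ?norm_mx_entry.
by rewrite sumr_const card_ord mulr_natl.
Qed.

Lemma gradient_mulmx (R : realType) (n : nat) (phi : 'cV[R]_n -> R)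
    (x v : 'cV[R]_n) : (gradient phi x *m v) 0 0 = 'd phi x v.
Proof.
rewrite [in RHS](matrix_sum_delta v) linear_sum /= mxE.
by apply: eq_bigr => i _; rewrite big_ord1 linearZ /= mxE mulrC.
Qed.

(** * Time shifts of solutions and monotonicity of H along the flow *)

Section flow_theory.
Context {R : realType} {n : nat}.
Implicit Types (F : 'cV[R]_n -> 'cV[R]_n) (x : 'cV[R]_n) (y : R -> 'cV[R]_n).

Lemma abs_continuous_translation (V : normedModType R) (a b c : R)
    (y : R -> V) : abs_continuous (a + c) (b + c) y ->
  abs_continuous a b (fun t => y (t + c)).
Proof.
move=> yac e e0; have [d d0 H] := yac e e0; exists d => // N s t st dis std.
apply: (H N (fun i => s i + c) (fun i => t i + c)).
- by move=> i; rewrite !lerD2r.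
- move=> i j _ _ [z [/= zi zj]]; apply: dis => //; exists (z - c).
  by move: zi zj; rewrite /= !in_itv /= !ltrBrDr !ltrBlDr.
- by under eq_bigr do rewrite opprD addrACA subrr addr0.
Qed.

Lemma is_derive_translation (V : normedModType R) (c t : R) (y : R -> V)
    (d : V) : is_derive (t + c) (1 : R) y d ->
  is_derive t (1 : R) (fun s => y (s + c)) d.
Proof.
have E : (fun h : R => h^-1 *: (((fun s => y (s + c)) \o shift t) (h *: 1) -
    y (t + c))) = (fun h => h^-1 *: ((y \o shift (t + c)) (h *: 1) - y (t + c))).
  by apply/funext => h /=; rewrite addrA.
move=> [yd <-]; split; first by rewrite /derivable E.
by rewrite /derive E.
Qed.

(** The vector field is autonomous, and [0 <= c] keeps shifted times in the range where the equation
    holds almost everywhere. *)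
Lemma is_solution_translation F x y (c : R) : 0 <= c ->
  is_solution F x y -> is_solution F (y c) (fun s => y (s + c)).
Proof.
move=> c0 [y0 yac yae]; split; first by rewrite add0r.
- move=> T T0; apply: abs_continuous_translation => e e0.
  have [|d d0 H] := yac (T + c) _ e e0; first by rewrite ltr_wpDr.
  exists d => // N s t st; apply: H => i; have [? ?] := st i.
  by split => //; apply: le_trans c0 _; rewrite -[c]add0r.
- apply: negligibleS (negligible_translation c yae) => t /= H.
  apply: contra_not H => H t0; apply: is_derive_translation.
  by apply: H; rewrite addr_ge0.
Qed.

Lemma flow_is_solution F x :
  has_unique_solution F x -> is_solution F x (flow F x).
Proof. by move=> [y Fy _]; rewrite /flow; apply: xgetPex; exists y. Qed.

(** Both sides are solutions from [flow F x t], where uniqueness identifies them. *)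
Lemma flow_add F x (s t : R) : has_unique_solution F x ->
  has_unique_solution F (flow F x t) -> 0 <= s -> 0 <= t ->
  flow F (flow F x t) s = flow F x (s + t).
Proof.
move=> Fx Fxt s0 t0; have [y _ yuniq] := Fxt.
have := is_solution_translation t0 (flow_is_solution Fx).
by move=> /yuniq -> //; apply: yuniq => //; exact: flow_is_solution.
Qed.

Lemma psi_le_Hfun (h : 'cV[R]_n -> R) F x (t : R) :
  Hdom h F x -> 0 <= t -> h (flow F x t) <= Hfun h F x.
Proof. by move=> [_ [_ ub]] t0; apply: ub_le_sup => //; exists t. Qed.

(** By [flow_add], the values of [h] ahead of [flow F x t] are among those ahead of [x], so the
    supremum is over a smaller set. *)
Lemma Hfun_flow_le (h : 'cV[R]_n -> R) F x (t : R) : Hdom h F x ->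
  has_unique_solution F (flow F x t) -> 0 <= t ->
  Hfun h F (flow F x t) <= Hfun h F x.
Proof.
move=> Hx Fxt t0; apply: ge_sup.
  by exists (psi h F 0 (flow F x t)); exists 0 => //=.
move=> _ [s /= s0 <-]; rewrite /psi flow_add //; last by case: Hx.
by apply: psi_le_Hfun => //; rewrite addr_ge0.
Qed.

End flow_theory.

(** * A control along which H hardly increases *)

(* Were every admissible direction uphill for H by at least c > 0, then
   p v = - dH(x) v + eta |v| would be at most - c / 2 on all velocities near x,
   so p (y t - x) < 0 for small t > 0; but - p bounds the increments of H at x
   from below. *)
Lemma exists_descent_control (R : realType) (n m : nat)
    (f : 'cV[R]_n -> 'cV[R]_n) (g : 'cV[R]_n -> 'M[R]_(n, m))
    (U : set 'cV[R]_m) (ustar : 'cV[R]_n -> 'cV[R]_m) (H : 'cV[R]_n -> R)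
    (x : 'cV[R]_n) (y : R -> 'cV[R]_n) (c : R) :
  {for x, continuous f} -> {for x, continuous g} -> bounded_set U ->
  (forall z, U (ustar z)) -> differentiable H x ->
  is_solution (closed_loop f g ustar) x y ->
  (forall t : R, 0 <= t -> H (y t) <= H x) -> 0 < c ->
  exists2 u, U u & 'd H x (f x + g x *m u) < c.
Proof.
move=> cf cg bU ustarU dH [y0 yac yae] Hy c0; apply: contrapT => noU.
have {noU} upU u : U u -> c <= 'd H x (f x + g x *m u).
  by move=> Uu; rewrite leNgt; apply/negP => ?; apply: noU; exists u.
have [K1 K10 dHK] : exists2 K1 : R, 0 < K1 & forall v, `|'d H x v| <= K1 * `|v|.
  apply/pinfty_ex_gt0/linear_boundedP/linear_bounded_continuous.
  exact: diff_continuous.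
have [B B0 UB] : exists2 B : R, 0 < B & forall u, U u -> `|u| <= B.
  exact: (pinfty_ex_gt0 bU).
pose M := `|f x| + m%:R * (`|g x| * B).
have M0 : 0 <= M by rewrite addr_ge0 // !mulr_ge0 // ltW.
have FM u : U u -> `|f x + g x *m u| <= M.
  move=> Uu; apply: (le_trans (ler_normD _ _)); rewrite lerD2l.
  apply: (le_trans (norm_mulmx_col _ _)).
  by rewrite !ler_wpM2l // UB.
have M1 : 0 < M + 1 by rewrite ltr_wpDl.
(* Chosen so that [eta * M <= c / 4]; [M + 1] is positive even if [M] vanishes. *)
pose eta := c / (4 * (M + 1)).
have eta0 : 0 < eta by rewrite divr_gt0 // mulr_gt0.
have etaM : eta * M <= c / 4.
  have -> : c / 4 = eta * (M + 1) by rewrite /eta invfM mulrA divfK // gt_eqF.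
  by rewrite ler_pM2l //; lra.
pose K := K1 + eta.
have K0 : 0 < K by rewrite addr_gt0.
pose p v := - 'd H x v + eta * `|v|.
have pD v w : p (v + w) <= p v + p w.
  rewrite /p linearD /=; have := ler_normD v w.
  by rewrite -(ler_pM2l eta0); lra.
have pZ (k : R) v : 0 <= k -> p (k *: v) = k * p v.
  move=> k0; rewrite /p linearZ /= normrZ ger0_norm //.
  by rewrite mulrDr mulrN [eta * _]mulrCA.
have pK v : p v <= K * `|v|.
  by rewrite /p mulrDl lerD2r (le_trans _ (dHK v)) // -normrN ler_norm.
(* Tolerance on the velocity, shared equally between the variations of [f] and [g]; it costs [p] at
   most [c / 4]. *)
pose theta := c / (4 * K).
have theta0 : 0 < theta by rewrite divr_gt0 // mulr_gt0.
have thetaK : K * theta = c / 4.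
  by rewrite /theta invfM mulrCA [K * _]mulrCA divff ?mulr1 // gt_eqF.
pose L := m%:R * B + 1.
have L0 : 0 < L by rewrite ltr_wpDl // mulr_ge0 // ltW.
have [r0 r00 Hr0] := differentiable_first_order dH eta0.
have [r1 r10 Hr1] : exists2 r1 : R, 0 < r1 & forall z, `|z - x| < r1 ->
    `|f z - f x| < theta / 2 /\ `|g z - g x| < theta / (2 * L).
  have nf : \forall z \near x, `|f z - f x| < theta / 2.
    by move/cvgrPdistC_lt : cf; apply; rewrite divr_gt0.
  have ng : \forall z \near x, `|g z - g x| < theta / (2 * L).
    by move/cvgrPdistC_lt : cg; apply; rewrite divr_gt0 // mulr_gt0.
  have : \forall z \near x,
      `|f z - f x| < theta / 2 /\ `|g z - g x| < theta / (2 * L).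
    exact: filterI nf ng.
  move=> /nbhs_normP [r1 /= r10 Hr1].
  by exists r1 => // z zx; apply: Hr1; rewrite /= distrC.
(* At [x] the value is at most [- c + c / 4], and moving to [z] adds at most [c / 4]. *)
have pF z u : `|z - x| < r1 -> U u -> p (f z + g z *m u) <= - (c / 2).
  move=> /Hr1[fz gz] Uu.
  have -> : f z + g z *m u = (f x + g x *m u) + ((f z - f x) + (g z - g x) *m u).
    by rewrite mulmxBl addrACA [f x + _]addrC subrK [g x *m u + _]addrC subrK.
  apply: (le_trans (pD _ _)).
  have gu : `|(g z - g x) *m u| <= theta / 2.
    apply: (le_trans (norm_mulmx_col _ _)).
    apply: (@le_trans _ _ (m%:R * (theta / (2 * L) * B))).
      by rewrite ler_wpM2l // ler_pM // ?UB // ltW.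
    have -> : theta / 2 = theta / (2 * L) * L by rewrite invfM mulrA divfK // gt_eqF.
    rewrite mulrCA ler_pM2l ?divr_gt0 ?mulr_gt0 //.
    by rewrite /L; lra.
  have rem : K * `|f z - f x + (g z - g x) *m u| <= c / 4.
    rewrite -thetaK ler_pM2l //; apply: (le_trans (ler_normD _ _)).
    by move: fz gu => /ltW; lra.
  have := pK (f z - f x + (g z - g x) *m u).
  have : p (f x + g x *m u) <= - c + c / 4.
    rewrite {1}/p lerD ?lerN2 ?upU // (le_trans _ etaM) //.
    by rewrite ler_pM2l // FM.
  lra.
(* Absolute continuity applied to the single interval from 0 to [t] keeps [y] near [x]. *)
have [d d0 Hd] : exists2 d : R, 0 < d & forall t, 0 <= t -> t <= 1 -> t < d ->
    `|y t - x| < Num.min r0 r1.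
  have [|d d0 Hd] := yac 1 ltr01 (Num.min r0 r1); first by rewrite lt_min r00.
  exists d => // t t0 t1 td.
  have := Hd 1%N (fun=> 0) (fun=> t); rewrite !big_ord1 subr0 y0; apply => //.
  by move=> i j _ _ _; rewrite !ord1.
pose T := Num.min 1 (d / 2).
have T0 : 0 < T by rewrite lt_min ltr01 divr_gt0.
have T1 : T <= 1 by rewrite ge_min lexx.
have Td : T < d by apply: (@le_lt_trans _ _ (d / 2)); [rewrite ge_min lexx orbT|lra].
have pT : p (y T - y 0) <= - (c / 2) * (T - 0).
  apply: (abs_continuous_sublinear_growth pD pZ K0 pK (ltW T0) (yac T T0)).
  apply: negligibleS yae => t /=; apply: contra_not => yt /andP[t0 tT].
  exists (closed_loop f g ustar (y t)); first exact: yt.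
  apply: pF => //; have := Hd t t0 (le_trans tT T1) (le_lt_trans tT Td).
  by rewrite lt_min => /andP[].
have : `|y T - x| < r0.
  by have := Hd T (ltW T0) T1 Td; rewrite lt_min => /andP[].
(* The expansion at [x] gives [H (y T) - H x >= - p (y T - x) >= c / 2 * T > 0], against [Hy]. *)
move=> /Hr0; rewrite ler_norml => /andP[HT _].
have := Hy T (ltW T0).
move: pT HT; rewrite y0 subr0 /p => pT HT.
have : 0 < c / 2 * T by rewrite mulr_gt0 // divr_gt0.
lra.
Qed.

Theorem theorem1 (R : realType) (n m r : nat) (U : set 'cV[R]_m)
  (f : 'cV[R]_n -> 'cV[R]_n) (g : 'cV[R]_n -> 'M[R]_(n, m))
  (h : 'cV[R]_n -> R) (ustar : 'cV[R]_n -> 'cV[R]_m)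
  (r_ge1 : (1 <= r)%N)
  (U_compact : compact U)
  (f_Cr : Ck r f) (g_Cr : Ck r g)
  (h_reldeg : relative_degree f g r h)
  (ustar_U : forall x, U (ustar x))
  (A1 : forall x, h x <= 0 -> has_unique_solution (closed_loop f g ustar) x)
  (A2 : forall x, h x <= 0 ->
     Hdom h (closed_loop f g ustar) x /\
     H_differentiable h (closed_loop f g ustar) x)
  (SH_neq0 : SH h (closed_loop f g ustar) !=set0) :
  zeroing_CBF f g U (SH h (closed_loop f g ustar))
    (Hfun h (closed_loop f g ustar)).
Proof.
case: r r_ge1 f_Cr g_Cr {h_reldeg} => // r _ [f_diff _] [g_diff _].
set F := closed_loop f g ustar; exists id; first by split => // s t.
move=> x [Hx Hx0].
(* The trajectory stays in S, so A1 and A2 apply along it, and at [x] itself by taking time 0. *)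
have h_flow t : 0 <= t -> h (flow F x t) <= 0.
  by move=> t0; apply: le_trans Hx0; exact: psi_le_Hfun.
have flow0 : flow F x 0 = x by have [] := flow_is_solution (proj1 Hx).
have [_ [_ dH]] : Hdom h F x /\ H_differentiable h F x.
  by apply: A2; rewrite -flow0; exact: h_flow.
apply/lee_addgt0Pr => e e0; rewrite add0e.
have [u Uu ue] : exists2 u, U u & 'd (Hfun h F) x (f x + g x *m u) < e.
  apply: (exists_descent_control _ _ (compact_bounded U_compact) ustar_U dH
    (flow_is_solution (proj1 Hx)) _ e0).
  - exact: differentiable_continuous.
  - exact: differentiable_continuous.
  - by move=> t t0; apply: Hfun_flow_le => //; apply/A1/h_flow.
apply: (@le_trans _ _ (Lf f (Hfun h F) x + (Lg g (Hfun h F) x *m u) 0 0 -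
    (- Hfun h F x))%:E).
  by apply: ereal_inf_lbound; exists u.
(* With the identity as class-K function, the last term contributes [Hfun h F x <= 0], so a slope
   below [e] suffices. *)
rewrite lee_fin /Lf /Lg -mulmxA !gradient_mulmx opprK.
by move: ue; rewrite linearD /=; lra.
Qed.
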